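(* Let $K_n$ be the complete graph of order $n$ and $k$ a positive integer. Then $d_R^k(K_n)=n$ if $n\ge 2k$; $d_R^k(K_n)\le 2k-1$ if $n\le 2k-1$; and $d_R^k(K_n)=2k-1$ if $k\ge 2$ and $2k-2\le n\le 2k-1$.
   Context: Let $k\ge1$ be an integer. A Roman $k$-dominating function (RkDF) on a graph $G$ is a map $f:V(G)\to\{0,1,2\}$ such that every vertex $v$ with $f(v)=0$ has at least $k$ neighbors $u$ with $f(u)=2$. A set $\{f_1,\ldots,f_d\}$ of pairwise distinct RkDFs on $G$ with $\sum_{i=1}^d f_i(v)\le 2k$ for every $v\in V(G)$ is a Roman $(k,k)$-dominating family on $G$; the maximum number of functions in such a family is the Roman $(k,k)$-domatic number $d_R^k(G)$. *)

(* Defs.v *)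
From mathcomp Require Import all_boot.

Set Implicit Arguments.
Unset Strict Implicit.
Unset Printing Implicit Defensive.

Record sgraph := SGraph {
  vertex :> finType;
  adj : rel vertex;
  adj_sym : symmetric adj;
  adj_irrefl : irreflexive adj }.

Section Roman.
Variables (k : nat) (G : sgraph).

(* A labelling V(G) -> {0,1,2}; the values are read in nat through 'I_3 >-> nat. *)
Definition labelling := {ffun G -> 'I_3}.

Definition roman_k_dominating (f : labelling) : bool :=
  [forall v : G, ((f v : nat) == 0) ==>
     (k <= #|[set u : G | adj v u & (f u : nat) == 2]|)].

(* Members of a {set _} are pairwise distinct by construction. *)
Definition roman_kk_dominating_family (F : {set labelling}) : bool :=
  [forall f in F, roman_k_dominating f] &&
  [forall v : G, \sum_(f in F) (f v : nat) <= 2 * k].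

Definition roman_kk_domatic_number : nat :=
  \max_(F : {set labelling} | roman_kk_dominating_family F) #|F|.

End Roman.

Section Complete.
Variable n : nat.

Definition complete_adj : rel 'I_n := fun x y => x != y.

Lemma complete_adj_sym : symmetric complete_adj.
Proof. by move=> x y; rewrite /complete_adj eq_sym. Qed.

Lemma complete_adj_irrefl : irreflexive complete_adj.
Proof. by move=> x; rewrite /complete_adj eqxx. Qed.

Definition complete_graph : sgraph :=
  SGraph complete_adj_sym complete_adj_irrefl.

End Complete.

(* Main.v *)
(** Double counting bounds the families: the weights of the members add up to at
    most 2kn, and a Roman k-dominating function weighs at least 2k if it takes the
    value 0, more than n if it is positive and not identically 1.
    For k < n the n cyclic translates of 2 * [v < k] form a family of size n. For
    n = 2k - 2 the constant function 1 together with the n functions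
    1 + [v = i] forms a family of size n + 1. *)
Require Import Defs.
From mathcomp Require Import all_boot all_algebra zify.

Set Implicit Arguments.
Unset Strict Implicit.
Unset Printing Implicit Defensive.

Section General.
Variables (k : nat) (G : sgraph).
Implicit Types (f : labelling G) (F : {set labelling G}).

Definition weight f := \sum_(v : G) (f v : nat).

(** The neighbours of value 2 that [v] requires already contribute [2 * k]. *)
Lemma roman_weight_ge f (v : G) :
  roman_k_dominating k f -> f v = 0 :> nat -> 2 * k <= weight f.
Proof.
move=> /forallP /(_ v) /implyP rf /eqP /rf le_k.
apply: (@leq_trans (\sum_(u in [set u | adj v u & (f u : nat) == 2]) f u)).
  rewrite (eq_bigr (fun=> 2)) => [|u]; last by rewrite inE => /andP[_ /eqP].
  by rewrite sum_nat_const; lia.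
by rewrite /weight [leqRHS](bigID (mem [set u | adj v u & (f u : nat) == 2])) leq_addr.
Qed.

(** Every vertex contributes at least 1, and a positive labelling other than the constant 1 has a
    vertex contributing 2; the boolean counts this extra unit. *)
Lemma positive_weight_ge f :
  (forall v : G, 0 < f v) -> #|G| + (f != [ffun=> inord 1]) <= weight f.
Proof.
move=> f_gt0; have card_le (A : pred G) : #|A| <= \sum_(v in A) f v.
  by rewrite -sum1_card leq_sum.
case: eqP => [_|/eqP f_neq1]; first by rewrite addn0 card_le.
have [v fv_neq1] : exists v : G, f v != 1 :> nat.
  apply/existsP; apply: contraR f_neq1 => /existsPn f1.
  apply/eqP/ffunP => v; apply/val_inj; rewrite ffunE /= inordK //.
  by apply/eqP; move: (f1 v); rewrite negbK.
rewrite /weight (bigD1 v) //= -(cardC (pred1 v)) card1 addnAC leq_add //.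
  by have := f_gt0 v; move: fv_neq1; lia.
exact: card_le (predC (pred1 v)).
Qed.

Lemma family_weight_le F :
  roman_kk_dominating_family k F -> \sum_(f in F) weight f <= 2 * k * #|G|.
Proof.
case/andP=> _ /forallP leF; rewrite exchange_big /= mulnC -sum_nat_const.
exact: leq_sum.
Qed.

Lemma roman_weight_min f :
  roman_k_dominating k f -> minn #|G| (2 * k) <= weight f.
Proof.
move=> rf; case: (boolP [exists v, f v == 0 :> nat]) => [/existsP[v /eqP fv]|/existsPn f_neq0].
  by rewrite geq_min (roman_weight_ge rf fv) orbT.
rewrite geq_min (leq_trans _ (positive_weight_ge _)) ?leq_addr // => v.
by rewrite lt0n f_neq0.
Qed.

Lemma domatic_number_le d :
  (forall F, roman_kk_dominating_family k F -> #|F| <= d) ->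
  roman_kk_domatic_number k G <= d.
Proof. by move=> le_d; apply/bigmax_leqP. Qed.

Lemma domatic_number_ge F :
  roman_kk_dominating_family k F -> #|F| <= roman_kk_domatic_number k G.
Proof. by move=> famF; rewrite /roman_kk_domatic_number (bigmax_sup F). Qed.

(** Here every member weighs at least [2 * k], so the factor [2 * k] cancels from the bound on the
    total weight. *)
Lemma domatic_number_le_order :
  0 < k -> 2 * k <= #|G| -> roman_kk_domatic_number k G <= #|G|.
Proof.
move=> k_gt0 le_kG; apply: domatic_number_le => F famF.
rewrite -(@leq_pmul2l (2 * k)) ?muln_gt0 //.
apply: leq_trans (family_weight_le famF); rewrite mulnC -sum_nat_const.
case/andP: famF => /forall_inP romF _; apply: leq_sum => f /romF /roman_weight_min.
by rewrite (minn_idPr le_kG).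
Qed.

Lemma domatic_number_small_order :
  0 < k -> #|G| < 2 * k -> roman_kk_domatic_number k G < 2 * k.
Proof.
move=> k_gt0 lt_Gk; rewrite -(prednK (n := 2 * k)) ?muln_gt0 // ltnS.
apply: domatic_number_le => F famF.
have := family_weight_le famF; case/andP: famF => /forall_inP romF _.
(* Only the constant 1 can weigh as little as [#|G|]; the indicator makes up for it, and it occurs
   at most once in [F]. *)
have lef f : f \in F -> #|G|.+1 <= weight f + (f == [ffun=> inord 1]).
  move=> /romF rf.
  case: (boolP [exists v, f v == 0 :> nat]) => [/existsP[v /eqP fv]|/existsPn f_neq0].
    by have := roman_weight_ge rf fv; lia.
  have /positive_weight_ge : forall v, 0 < f v by move=> v; rewrite lt0n f_neq0.
  by case: eqP => /= _; lia.
have : \sum_(f in F) #|G|.+1 <= \sum_(f in F) (weight f + (f == [ffun=> inord 1])).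
  exact: leq_sum.
rewrite sum_nat_const big_split /=.
have : \sum_(f in F) (f == [ffun=> inord 1] : nat) <= 1.
  rewrite -big_mkcondr /= sum1_card (leq_trans (subset_leq_card _) (eq_leq (card1 [ffun=> inord 1]))) //.
  by apply/subsetP => f /andP[].
(* If [a >= 2 * k], then [2 * k * g.+1 <= 2 * k * g + 1], which is impossible since [2 * k > 1]. *)
have arith a g s e : e <= 1 -> a * g.+1 <= s + e -> s <= 2 * k * g -> a <= (2 * k).-1.
  by nia.
exact: arith.
Qed.

End General.

Section CyclicFamily.
Variables (m k : nat).
Local Notation n := m.+2.
Local Notation G := (complete_graph n).

(** The value is 2 on the cyclic interval of [k] vertices starting at [i]. Subtraction is modulo
    [n]; the form [m.+2] gives ['I_n] its ring structure. *)
Definition translate (i : 'I_n) : labelling G :=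
  [ffun v : 'I_n => if (v - i)%R < k then inord 2 else ord0].

Lemma translateE i (v : 'I_n) : translate i v = 2 * ((v - i)%R < k) :> nat.
Proof. by rewrite ffunE; case: ifP => //= _; rewrite inordK. Qed.

Lemma sum_ord_lt : k < n -> \sum_(i < n) (i < k) = k.
Proof.
move=> lt_kn; rewrite -big_mkcond /= -(big_ord_widen _ (fun=> 1)) ?(ltnW lt_kn) //.
by rewrite sum1_card card_ord.
Qed.

(** The start of a proper cyclic interval is its only element whose predecessor lies outside it. *)
Lemma translate_inj : 0 < k < n -> injective translate.
Proof.
move=> /andP[k_gt0 lt_kn] i j eq_ij.
have eqb v : ((v - i)%R < k) = ((v - j)%R < k).
  by have := translateE i v; rewrite eq_ij translateE; do 2!case: (_ < k).
have := eqb j; rewrite GRing.subrr k_gt0; set w := (j - i)%R => lt_wk.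
have := eqb (j - 1)%R; rewrite -!GRing.addrA ![(-1 + _)%R]GRing.addrC !GRing.addrA.
rewrite GRing.subrr GRing.sub0r -/w.
(* The residue of -1 is [n - 1], which is at least [k]. *)
have -> : ((-1 : 'I_n)%R < k) = false.
  by rewrite /= !modn_small // ?subn1 /=; lia.
case: (posnP w) => [w0 _|w_gt0].
  by apply/esym/eqP; rewrite -GRing.subr_eq0; apply/eqP/val_inj.
(* For [w > 0] the subtraction does not wrap around, so [w - 1] would still be below [k]. *)
have -> : (w - 1)%R = w.-1%:R%R :> 'I_n.
  by rewrite -[in LHS](natr_Zp w) -{1}(prednK w_gt0) -GRing.natr1 GRing.addrK.
by rewrite (val_Zp_nat (p := n) isT) modn_small; have := ltn_ord w; lia.
Qed.

Lemma cyclic_family :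
  0 < k < n -> roman_kk_dominating_family k [set translate i | i : 'I_n].
Proof.
move=> /[dup] lt_kn /andP[_ lt_k_n]; apply/andP; split.
  apply/forall_inP => _ /imsetP[i _ ->]; apply/forallP => v; apply/implyP => /eqP fv0.
  (* The number [k] is rewritten as the count of the [u] of value 2; each differs from [v], hence is
     adjacent to it. *)
  rewrite -{1}(sum_ord_lt lt_k_n) (reindex_inj (GRing.addIr (- i)%R)) /=.
  rewrite -big_mkcond /= sum1_card; apply/subset_leq_card/subsetP => u lt_u.
  have fu2 : translate i u = 2 :> nat by rewrite translateE (_ : (u - i)%R < k).
  rewrite inE fu2 eqxx andbT; apply/eqP => eq_uv.
  by move: fu2; rewrite -eq_uv fv0.
apply/forallP => v; rewrite big_imset /=; last by move=> i j _ _; apply: translate_inj.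
under eq_bigr do rewrite translateE.
(* The involution [i] to [v - i] shows that exactly [k] translates take the value 2 at [v]. *)
rewrite -big_distrr (reindex_inj (h := fun i : 'I_n => (v - i)%R)).
  by under eq_bigr do rewrite GRing.subKr; rewrite sum_ord_lt.
by move=> i j /GRing.addrI/GRing.oppr_inj.
Qed.

End CyclicFamily.

Lemma complete_domatic_number_ge n k :
  0 < k < n -> n <= roman_kk_domatic_number k (complete_graph n).
Proof.
case: n => [|[|m]] lt_kn; try lia.
have := domatic_number_ge (cyclic_family lt_kn).
by rewrite card_imset ?card_ord //; apply: translate_inj.
Qed.

Section BumpFamily.
Variable n : nat.
Local Notation G := (complete_graph n).

(** [None] encodes the constant 1, [Some i] the labelling raised to 2 at [i]. *)
Definition bump_labelling (o : option 'I_n) : labelling G :=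
  [ffun v => inord (1 + (o == Some v))].

Lemma bump_labellingE o v : bump_labelling o v = 1 + (o == Some v) :> nat.
Proof. by rewrite ffunE inordK //; case: eqP. Qed.

Lemma bump_labelling_inj : injective bump_labelling.
Proof.
move=> o1 o2 eq_o.
have eqb v : (o1 == Some v) = (o2 == Some v).
  by have := bump_labellingE o1 v; rewrite eq_o bump_labellingE; do 2!case: (_ == _).
case: o1 o2 eqb {eq_o} => [i|] [j|] // eqb.
- by have := eqb j; rewrite eqxx => /eqP.
- by have := eqb i; rewrite eqxx.
- by have := eqb j; rewrite eqxx.
Qed.

(** No value is 0, so domination is vacuous; at each vertex the [n.+1] labellings sum to [n.+2]. *)
Lemma bump_family k :
  n.+2 <= 2 * k -> roman_kk_dominating_family k [set bump_labelling o | o : option 'I_n].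
Proof.
move=> le_nk; apply/andP; split.
  apply/forall_inP => _ /imsetP[o _ ->]; apply/forallP => v.
  by rewrite bump_labellingE.
apply/forallP => v; rewrite big_imset /=; last by move=> i j _ _; apply: bump_labelling_inj.
under eq_bigr do rewrite bump_labellingE.
rewrite big_split /= sum1_card -big_mkcond /= sum1_card card1 card_option card_ord.
by lia.
Qed.

Lemma bump_domatic_number_ge k :
  n.+2 <= 2 * k -> n < roman_kk_domatic_number k G.
Proof.
move=> /bump_family /domatic_number_ge; rewrite card_imset; last exact: bump_labelling_inj.
by rewrite card_option card_ord.
Qed.

End BumpFamily.

Theorem theorem3 (n k : nat) (hk : 1 <= k) :
  [/\ 2 * k <= n -> roman_kk_domatic_number k (complete_graph n) = n,
      n <= 2 * k - 1 -> roman_kk_domatic_number k (complete_graph n) <= 2 * k - 1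
    & 2 <= k -> 2 * k - 2 <= n <= 2 * k - 1 ->
      roman_kk_domatic_number k (complete_graph n) = 2 * k - 1].
Proof.
have cardG : #|complete_graph n| = n by exact: card_ord.
have small : n <= 2 * k - 1 -> roman_kk_domatic_number k (complete_graph n) <= 2 * k - 1.
  have := @domatic_number_small_order k (complete_graph n) hk; rewrite cardG.
  by move=> lt2k le_n; move: (lt2k ltac:(lia)); lia.
split=> // [le_kn|le2k /andP[le1 le2]].
  apply/eqP; rewrite eqn_leq complete_domatic_number_ge ?andbT; last by lia.
  by have := @domatic_number_le_order k (complete_graph n) hk; rewrite cardG; apply.
apply/eqP; rewrite eqn_leq small //=.
(* For [n = 2 * k - 2] the bump family has [n.+1] members; for [n = 2 * k - 1] the cyclic family has
   [n], where [k < n] because [2 <= k]. *)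
case: (ltnP n (2 * k - 1)) => le_n.
  by apply: leq_trans (bump_domatic_number_ge _); lia.
by apply: (leq_trans le_n); apply: complete_domatic_number_ge; lia.
Qed.
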